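(* Let $S$ be a zero-dimensional (that is, $\dim(S)=0$), simple, weakly cancellative $\mathrm{Cu}$-semigroup satisfying (O5). Then $S$ has the Riesz interpolation property. If additionally $S$ is nonelementary, then $S$ is almost divisible.
   Context: Way-below relation: in a partially ordered set, $x\ll y$ means that for every increasing sequence $(z_n)_n$ that has a supremum $z$ with $y\leq z$ there exists $n$ with $x\leq z_n$. A $\mathrm{Cu}$-semigroup is an abelian monoid $S$ with a partial order such that $0\leq x$ for all $x$, and $x\leq y$ implies $x+z\leq y+z$, satisfying: (O1) every increasing sequence has a supremum; (O2) every element is the supremum of a $\ll$-increasing sequence (i.e. $x_n\ll x_{n+1}$ for all $n$); (O3) $x'\ll x$ and $y'\ll y$ imply $x'+y'\ll x+y$; (O4) $\sup_n x_n+\sup_n y_n=\sup_n(x_n+y_n)$ for increasing sequences $(x_n)_n,(y_n)_n$. (O5): given $x+y\leq z$, $x'\ll x$ and $y'\ll y$, there exists $c$ such that $x'+c\leq z\leq x+c$ and $y'\ll c$. Weakly cancellative: $x+z\ll y+z$ implies $x\ll y$. Simple: for all $x,y\in S$ with $y\neq0$ we have $x\leq\infty y$, where $\infty y:=\sup_n ny$. Elementary: a simple $\mathrm{Cu}$-semigroup is elementary if it is $\{0\}$ or contains a minimal nonzero element; it is nonelementary otherwise. Riesz interpolation property: if $x_0,x_1,y_0,y_1\in S$ satisfy $x_j\leq y_k$ for all $j,k\in\{0,1\}$, then there exists $z\in S$ with $x_j\leq z\leq y_k$ for all $j,k\in\{0,1\}$. Almost divisible: for every $n\geq1$ and all $x',x\in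 S$ with $x'\ll x$ there exists $z\in S$ such that $nz\ll x$ and $x'\ll(n+1)z$. Dimension (with $\mathbb{N}=\{0,1,2,\ldots\}$): for a $\mathrm{Cu}$-semigroup $S$ and $n\in\mathbb{N}$, write $\dim(S)\leq n$ if, whenever $x'\ll x\ll y_1+\ldots+y_r$ in $S$, there exist $z_{j,k}\in S$ for $j=1,\ldots,r$ and $k=0,\ldots,n$ such that (i) $z_{j,k}\ll y_j$ for all $j,k$; (ii) $x'\ll\sum_{j,k}z_{j,k}$; (iii) $\sum_{j=1}^r z_{j,k}\ll x$ for each $k=0,\ldots,n$. Then $\dim(S)$ is the smallest such $n$, and $\dim(S)=\infty$ if no such $n$ exists. *)

(* Defs.v *)
From HB Require Import structures.
From mathcomp Require Import all_boot all_order ssralg.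
From mathcomp Require Import boolp classical_sets.

Set Implicit Arguments.
Unset Strict Implicit.
Unset Printing Implicit Defensive.

Import Order.TTheory GRing.Theory.

Local Open Scope classical_set_scope.
Local Open Scope ring_scope.
Local Open Scope order_scope.

(* Weakly increasing, stated on consecutive terms; equivalent by transitivity
   to {homo u : m n / (m <= n)%N >-> m <= n}. *)
Definition increasing d (T : porderType d) (u : nat -> T) : Prop :=
  forall n, u n <= u n.+1.

Definition seq_sup d (T : porderType d) (u : nat -> T) (x : T) : Prop :=
  isLub (range u) x.

(* Only the sequences that do have a supremum are tested: in a general partial
   order, suprema of increasing sequences need not exist. *)
Definition way_below d (T : porderType d) (x y : T) : Prop :=
  forall (u : nat -> T) (z : T),
    increasing u -> seq_sup u z -> y <= z -> exists n, x <= u n.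

Notation "x `<< y" := (way_below x y) (at level 70, no associativity)
  : order_scope.

(* Pitfall: ssrnum has its own join of the order and additive hierarchies,
   [Num.POrderedZmodule], which requires opposites. Importing ssrnum next to this
   file makes type inference for terms such as [0 <= x] ambiguous, so only ssralg
   is imported here. *)
#[short(type="porderNmodType")]
HB.structure Definition POrderNmodule d :=
  { S of Order.POrder d S & GRing.Nmodule S }.

(* [porderType] and [nmodType] include a decidable equality and a choice
   operator; by the classical axioms of [boolp] every type has both, so this does
   not restrict the carrier. *)
HB.mixin Record isCuSemigroup d S of Order.POrder d S & GRing.Nmodule S := {
  cu_le0x : forall x : S, 0 <= x;
  cu_leD2r : forall x y z : S, x <= y -> x + z <= y + z;
  cu_O1 : forall u : nat -> S, increasing u -> exists x, seq_sup u x;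
  cu_O2 : forall x : S,
    exists u : nat -> S, (forall n, u n `<< u n.+1) /\ seq_sup u x;
  cu_O3 : forall x' x y' y : S, x' `<< x -> y' `<< y -> x' + y' `<< x + y;
  cu_O4 : forall (u v : nat -> S) (x y : S),
    increasing u -> increasing v -> seq_sup u x -> seq_sup v y ->
    seq_sup (fun n => u n + v n) (x + y)
}.

#[short(type="cuSemigroupType")]
HB.structure Definition CuSemigroup d :=
  { S of isCuSemigroup d S & Order.POrder d S & GRing.Nmodule S }.

Definition axiom_O5 d (S : cuSemigroupType d) : Prop :=
  forall x y z x' y' : S, x + y <= z -> x' `<< x -> y' `<< y ->
    exists c : S, [/\ x' + c <= z, z <= x + c & y' `<< c].

Definition weakly_cancellative d (S : cuSemigroupType d) : Prop :=
  forall x y z : S, x + z `<< y + z -> x `<< y.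

(* The sequence [y *+ n] is increasing, so its supremum exists by (O1) and the
   default value 0 passed to [supremum] is never returned. *)
Definition infty_mul d (S : cuSemigroupType d) (y : S) : S :=
  supremum 0 (range (fun n : nat => y *+ n)).

Definition simple d (S : cuSemigroupType d) : Prop :=
  forall x y : S, y <> 0 -> x <= infty_mul y.

Definition minimal_nonzero d (S : cuSemigroupType d) (x : S) : Prop :=
  x <> 0 /\ forall y : S, y <> 0 -> y <= x -> y = x.

(* Meaningful for simple Cu-semigroups only. *)
Definition elementary d (S : cuSemigroupType d) : Prop :=
  (forall x : S, x = 0) \/ (exists x : S, minimal_nonzero x).

Definition riesz_interpolation d (S : cuSemigroupType d) : Prop :=
  forall x y : 'I_2 -> S, (forall j k, x j <= y k) ->
    exists z : S, forall j k, x j <= z /\ z <= y k.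

Definition almost_divisible d (S : cuSemigroupType d) : Prop :=
  forall (n : nat) (x' x : S), (1 <= n)%N -> x' `<< x ->
    exists z : S, z *+ n `<< x /\ x' `<< z *+ n.+1.

(* The case r = 0 asks nothing: 0 is way below itself and only 0 is below 0. *)
Definition dim_le d (S : cuSemigroupType d) (n : nat) : Prop :=
  forall (x' x : S) (r : nat) (y : 'I_r -> S),
    x' `<< x -> x `<< (\sum_(j < r) y j)%R ->
    exists z : 'I_r -> 'I_n.+1 -> S,
      [/\ forall j k, z j k `<< y j,
          x' `<< (\sum_(j < r) \sum_(k < n.+1) z j k)%R
        & forall k, (\sum_(j < r) z j k)%R `<< x].

(* [None] stands for infinite dimension. *)
Definition cu_dim d (S : cuSemigroupType d) : option nat :=
  if pselect (exists n, `[< dim_le S n >]) is left e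
  then Some (ex_minn e) else None.

(* Main.v *)
Require Import Defs.
From HB Require Import structures.
From mathcomp Require Import all_boot all_order ssralg.
From mathcomp Require Import boolp classical_sets.

(** Both halves imitate arguments for cancellative refinement monoids, such as
    the monoid of projections of a C*-algebra of real rank zero and stable rank
    one. There, when [a] and [b] lie below [y = a + c] and [w = a + g], one refines
    [b <= a + c] to [b = u + v] with [u <= a] and [v <= c], writes [a = u + q],
    cancels [u] from [u + v <= w = u + q + g], refines [v] to [q1 + g1] with
    [q1 <= q] and [g1 <= g], and finds that [a + g1] interpolates. For
    divisibility one writes [x = y *+ m + r] with [m] large and [r] below a
    multiple of [y], and splits [y] into pieces such that [x] is a sum of
    multiples of these pieces. Each multiplicity is at least [m], and hence a
    combination of [n] and [n.+1].

    In a Cu-semigroup there may be no compact elements besides 0, and every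
    complement given by (O5) is only approximate: for [t] way below [t0] and
    [t0 <= y] it provides [c] with [t + c <= y <= t0 + c]. The remedy is to
    work with pairs [t << t0 <= t + e], for an error [e] so small that it can
    be cancelled in the end. An error [e] is called [fine] if such pairs exist
    between any two elements in the relation [<<], up to adding [e] twice.

    - Every nonzero [e] is fine ([fine_neq0]). For a chain
      [f0 << f1 << .. << fn << e], the sums [h0] of the first [n] terms and
      [h1] of the last [n] terms satisfy [h0 << h1 <= h0 + e], while [h1] is at
      least [f0 *+ n], hence as large as desired by simplicity. Zero-dimensional
      splitting of [h1] and weak cancellation pass the property from [h1] to its
      summands ([fine_of_large]).
    - If there is a nonzero compact element [p], then 0 is fine as well
      ([fine0]), because the multiples of [p] are large pairs without error.
    - Finitely many strict relations [a << w] with [w] nonzero always leave room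
      for a multiple of some fine error ([fine_slack]). If there is a nonzero
      compact element, the error is 0. Otherwise no nonzero [w] is compact, so
      (O5) leaves a nonzero gap between [a] and [w], and nonzero elements
      have arbitrarily small nonzero fractions ([small_multiple]).

    With these tools, [interpolation_of_tight] and [divide_with_error] carry out
    the two monoid arguments. Weak cancellation of the accumulated error gives
    strict relations, and suprema of sequences give full interpolation. *)

Set Implicit Arguments.
Unset Strict Implicit.
Unset Printing Implicit Defensive.

Import Order.TTheory GRing.Theory.

Local Open Scope ring_scope.
Local Open Scope order_scope.

(** * Order and addition in a Cu-semigroup *)

Section CuBasics.

Context {d : Order.disp_t} {S : cuSemigroupType d}.
Implicit Types a b c e f g h p t x y z w : S.

Lemma cu_leD a b x y : a <= b -> x <= y -> a + x <= b + y.
Proof.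
move=> ab xy; apply: le_trans (cu_leD2r _ _ x ab) _.
by rewrite ![b + _]addrC; apply: cu_leD2r.
Qed.

Lemma cu_leDl x y : x <= x + y.
Proof. by rewrite -{1}[x]addr0; apply: cu_leD => //; apply: cu_le0x. Qed.

Lemma cu_leDr x y : x <= y + x.
Proof. by rewrite addrC; apply: cu_leDl. Qed.

Lemma cu_leMn n x y : x <= y -> x *+ n <= y *+ n.
Proof.
by move=> xy; elim: n => [|n IH]; rewrite ?mulr0n // !mulrS; apply: cu_leD.
Qed.

Lemma cu_leMnr m n x : (m <= n)%N -> x *+ m <= x *+ n.
Proof. by move=> /subnKC <-; rewrite mulrnDr; apply: cu_leDl. Qed.

Lemma cu_le0_eq x : x <= 0 -> x = 0.
Proof. by move=> x0; apply/le_anti; rewrite x0 cu_le0x. Qed.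

Lemma cu_neq0_le x y : x <> 0 -> x <= y -> y <> 0.
Proof. by move=> x0 xy y0; apply: x0; apply: cu_le0_eq; rewrite -y0. Qed.

Lemma increasing_le (u : nat -> S) m n :
  increasing u -> (m <= n)%N -> u m <= u n.
Proof.
move=> iu /subnKC <-; elim: (n - m)%N => [|k IH]; first by rewrite addn0.
by rewrite addnS; apply: le_trans IH (iu _).
Qed.

Lemma seq_sup_ub (u : nat -> S) x n : seq_sup u x -> u n <= x.
Proof. by case=> ub _; apply: ub; exists n. Qed.

Lemma seq_sup_le (u : nat -> S) x y :
  seq_sup u x -> (forall n, u n <= y) -> x <= y.
Proof. by case=> _ lub uy; apply: lub => _ [n _ <-]. Qed.

Lemma way_below_le x y : x `<< y -> x <= y.
Proof.
move=> xy; have [|||n //] := xy (fun _ => y) y; first by move=> n.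
by split=> [_ [n _ <-] //|b ub]; apply: ub; exists 0%N.
by [].
Qed.

Lemma way_below_le_trans x y z : x `<< y -> y <= z -> x `<< z.
Proof. by move=> xy yz u s iu us zs; apply: xy iu us (le_trans yz zs). Qed.

Lemma le_way_below_trans x y z : x <= y -> y `<< z -> x `<< z.
Proof.
move=> xy yz u s iu us zs; have [n yn] := yz u s iu us zs.
by exists n; apply: le_trans xy yn.
Qed.

Lemma way_below_trans x y z : x `<< y -> y `<< z -> x `<< z.
Proof. by move=> /way_below_le; apply: le_way_below_trans. Qed.

Lemma way_below0 x : (0 : S) `<< x.
Proof. by move=> u s _ _ _; exists 0%N; apply: cu_le0x. Qed.

Lemma way_belowMn n x y : x `<< y -> x *+ n `<< y *+ n.
Proof.
move=> xy; elim: n => [|n IH]; first exact: way_below0.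
by rewrite !mulrS; apply: cu_O3.
Qed.

Lemma way_below_seqP x : exists u : nat -> S,
  [/\ increasing u, seq_sup u x, forall n, u n `<< u n.+1 &
      forall n, u n `<< x].
Proof.
have [u [uu ux]] := cu_O2 x; exists u.
split=> // n; first exact: way_below_le.
exact: way_below_le_trans (uu n) (seq_sup_ub _ ux).
Qed.

Lemma way_below_directed a b y : a `<< y -> b `<< y ->
  exists c, [/\ a `<< c, b `<< c & c `<< y].
Proof.
move=> ay yb; have [u [iu us uu ub]] := way_below_seqP y.
have [m am] := ay u y iu us (lexx _).
have [n bn] := yb u y iu us (lexx _).
exists (u (maxn m n).+1); split=> //.
  apply: le_way_below_trans (uu _); apply: le_trans am _.
  by apply: increasing_le; rewrite // leq_maxl.
apply: le_way_below_trans (uu _); apply: le_trans bn _.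
by apply: increasing_le; rewrite // leq_maxr.
Qed.

Lemma way_below_interp x y : x `<< y -> exists2 z, x `<< z & z `<< y.
Proof. by move=> xy; have [z []] := way_below_directed xy xy; exists z. Qed.

Lemma way_below_neq0 x : x <> 0 -> exists2 y, y <> 0 & y `<< x.
Proof.
move=> x0; have [u [iu us uu ux]] := way_below_seqP x.
apply: contrapT => noy; apply: x0; apply: cu_le0_eq.
apply: seq_sup_le us _ => n; case: (eqVneq (u n) 0) => [->//|/eqP un0].
by case: noy; exists (u n).
Qed.

Lemma way_below_interp_neq0 x y : x `<< y -> y <> 0 ->
  exists z, [/\ z <> 0, x `<< z & z `<< y].
Proof.
move=> xy /way_below_neq0 [z z0 zy].
have [c [xc zc cy]] := way_below_directed xy zy.
by exists c; split=> //; apply: cu_neq0_le z0 (way_below_le zc).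
Qed.

(** Addition preserves suprema, so whatever lies way below a sum already lies
    below a sum of approximants of the two terms. *)
Lemma way_belowD_split a x y : a `<< x + y ->
  exists x' y', [/\ x' `<< x, y' `<< y & a `<< x' + y'].
Proof.
move=> axy; have [u [iu us uu ux]] := way_below_seqP x.
have [v [iv vs vv vy]] := way_below_seqP y.
have [a1 aa1 a1xy] := way_below_interp axy.
have iuv : increasing (fun n => u n + v n) by move=> n; apply: cu_leD.
have [n an] := a1xy _ _ iuv (cu_O4 _ _ _ _ iu iv us vs) (lexx _).
by exists (u n), (v n); split=> //; apply: way_below_le_trans an.
Qed.

Lemma infty_mul_sup y : seq_sup (fun n => y *+ n) (infty_mul y).
Proof.
have iy : increasing (fun n => y *+ n).
  by move=> n; apply: cu_leMnr.
have [s sP] := cu_O1 _ iy.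
rewrite /infty_mul /supremum; case: ifP => [/eqP r0|_].
  have : range (fun n => y *+ n) (y *+ 0) by exists 0%N.
  by rewrite r0.
apply: (@xgetPex _ 0 (supremums (range (fun n => y *+ n)))).
exists s; exact: sP.
Qed.

(** A minimal nonzero element equals each of its nonzero approximants. *)
Lemma minimal_nonzero_way_below x : minimal_nonzero x -> x `<< x.
Proof.
move=> [x0 minx]; have [y y0 yx] := way_below_neq0 x0.
by rewrite -{1}(minx y y0 (way_below_le yx)).
Qed.

End CuBasics.

(** * Splitting elements below sums *)

Lemma cu_dim_le d (S : cuSemigroupType d) n : cu_dim S = Some n -> dim_le S n.
Proof.
rewrite /cu_dim; case: pselect => // ex [<-].
by case: ex_minnP => m /asboolP.
Qed.

Lemma dim_le0_split d (S : cuSemigroupType d) (x' x y1 y2 : S) :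
  dim_le S 0 -> x' `<< x -> x `<< y1 + y2 ->
  exists z1 z2, [/\ z1 `<< y1, z2 `<< y2, x' `<< z1 + z2 & z1 + z2 `<< x].
Proof.
move=> dim0 x'x xy.
have sum2 (u : 'I_2 -> S) : (\sum_(j < 2) u j)%R = u ord0 + u ord_max.
  by rewrite big_ord_recl big_ord1; congr (_ + u _); apply: val_inj.
have [|z [zy x'z zx]] :=
  dim0 x' x 2%N (fun j => if j == ord0 then y1 else y2) x'x.
  by rewrite sum2.
exists (z ord0 ord0), (z ord_max ord0); split.
- exact: (zy ord0 ord0).
- exact: (zy ord_max ord0).
- by move: x'z; rewrite sum2 !big_ord1.
- by move: (zx ord0); rewrite sum2.
Qed.

(* In what follows, primed letters denote approximants from below of the
   elements that carry the same letter. *)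

Section ZeroDimensional.

Context {d : Order.disp_t} {S : cuSemigroupType d}.
Hypothesis dim0 : dim_le S 0.
Hypothesis simpleS : simple S.
Hypothesis wcancel : weakly_cancellative S.
Hypothesis O5 : axiom_O5 S.
Implicit Types a b c e f g h p t x y z w : S.

Lemma split2 x' x y1 y2 : x' `<< x -> x `<< y1 + y2 ->
  exists z1' z1 z2' z2, [/\ z1' `<< z1 /\ z1 `<< y1, z2' `<< z2 /\ z2 `<< y2,
    x' `<< z1' + z2' & z1 + z2 `<< x].
Proof.
move=> x'x xy.
have [z1 [z2 [zy1 zy2 x'z zx]]] := dim_le0_split dim0 x'x xy.
have [z1' [z2' [z1z z2z x'z']]] := way_belowD_split x'z.
by exists z1', z1, z2', z2.
Qed.

Lemma split3 x' x y1 y2 y3 : x' `<< x -> x `<< y1 + y2 + y3 ->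
  exists z1' z1 z2' z2 z3,
   [/\ z1' `<< z1 /\ z1 `<< y1, z2' `<< z2 /\ z2 `<< y2, z3 `<< y3,
    x' `<< z1' + z2' + z3 & z1 + z2 + z3 `<< x].
Proof.
move=> x'x xy.
have [w' [w [z3' [z3 [[w'w wy] [zz zy] x'w wx]]]]] := split2 x'x xy.
have [z1' [z1 [z2' [z2 [H1 H2 w'z zw]]]]] := split2 w'w wy.
exists z1', z1, z2', z2, z3; split=> //.
  apply: way_below_le_trans x'w _.
  by apply: cu_leD; apply: way_below_le.
by apply: le_way_below_trans wx; apply: cu_leD => //; apply: way_below_le.
Qed.

(** The case [y = 0] of (O5): an element below [z] has an approximate complement
    in [z]. *)
Lemma complement x' x z : x' `<< x -> x <= z ->
  exists2 c, x' + c <= z & z <= x + c.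
Proof.
move=> x'x xz; have [|c [x'c zc _]] := @O5 x 0 z x' 0 _ x'x (@way_below0 _ S 0).
  by rewrite addr0.
by exists c.
Qed.

Lemma way_below_mulrn x' x y : y <> 0 -> x' `<< x -> exists n, x' <= y *+ n.
Proof.
move=> y0 x'x; apply: x'x (infty_mul_sup y) (simpleS _ y0) => n.
exact: cu_leMnr.
Qed.

(** Simplicity puts an approximant of [x] below a multiple of [y]. Splitting it
    along the copies of [y] leaves a nonzero piece below one of them. *)
Lemma common_lower_bound x y : x <> 0 -> y <> 0 ->
  exists z, [/\ z <> 0, z <= x & z <= y].
Proof.
move=> /way_below_neq0 [x1 x10 x1x] y0.
have [n x1n] := way_below_mulrn y0 x1x.
have {x1n} [x2 x20 [x2x x2n]] : exists2 x2, x2 <> 0 & x2 <= x /\ x2 `<< y *+ n.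
  have [x2 x20 x21] := way_below_neq0 x10.
  exists x2 => //; split; last exact: way_below_le_trans x21 x1n.
  by apply: way_below_le; apply: way_below_trans x21 x1x.
elim: n x2 x20 x2x x2n => [|n IH] x2 x20 x2x x2n.
  by case: x20; apply: cu_le0_eq; apply: way_below_le x2n.
have [x3 x30 x32] := way_below_neq0 x20.
have [|z1 [z2 [zy zn x3z zx]]] :=
  dim_le0_split dim0 x32 (y1 := y) (y2 := y *+ n).
  by rewrite -mulrS.
have zx2 := way_below_le zx.
case: (eqVneq z1 0) => [z10|/eqP z10]; last first.
  exists z1; split=> //; last exact: way_below_le.
  exact: le_trans (cu_leDl _ _) (le_trans zx2 x2x).
apply: (IH z2) => //; last exact: le_trans (cu_leDr _ _) (le_trans zx2 x2x).
by apply: cu_neq0_le x30 _; apply: way_below_le; rewrite z10 add0r in x3z.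
Qed.

(** As [x] is not minimal, it contains a sum [y1 + c] of two nonzero elements.
    If [m] copies of [z] fit into [y1], then a common lower bound of [z] and [c]
    fits [m.+1] times into [x]. *)
Lemma small_multiple m x : ~ (exists y : S, minimal_nonzero y) -> x <> 0 ->
  exists2 y, y <> 0 & y *+ m <= x.
Proof.
move=> nomin; elim: m x => [|m IH] x x0; first by exists x; rewrite ?cu_le0x.
have [y [y0 yx ynx]] : exists y, [/\ y <> 0, y <= x & y <> x].
  apply: contrapT => no; apply: nomin; exists x; split=> // y y0 yx.
  by apply: contrapT => ynx; apply: no; exists y.
have [y1 y10 y1y] := way_below_neq0 y0.
have [y2 y12 y2y] := way_below_interp y1y.
have y2x : y2 <= x by apply: le_trans (way_below_le y2y) yx.
have [c y1c cx] := complement y12 y2x.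
have c0 : c <> 0.
  (* A zero complement would give [x <= y2 <= y], hence [x = y]. *)
  move=> c0; apply: ynx; apply/le_anti; rewrite yx /=.
  by apply: le_trans (way_below_le y2y); rewrite c0 addr0 in cx.
have [z z0 zm] := IH y1 y10.
have [w [w0 wz wc]] := common_lower_bound z0 c0.
exists w => //; apply: le_trans y1c; rewrite mulrSr; apply: cu_leD => //.
exact: le_trans (cu_leMn _ wz) zm.
Qed.

(** * Fine errors *)

(** The pair [t << t0 <= t + e] replaces a compact element up to the error [e]:
    for [e = 0] it forces [t = t0] to be compact, and [fine 0] says that the
    compact elements are dense. Whereas [t0] lies strictly below [x], being
    above [x'] is only required up to errors, removed in [fine_approx]. *)
Definition fine e := forall x' x, x' `<< x ->
  exists t t0, [/\ t `<< t0, t0 `<< x, t0 <= t + e & x' `<< t + e + e].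

(** A pair [h0 << h1 <= h0 + e] with [h1] large suffices. If [c] is an
    approximate complement of a piece of [x] in [h1], then splitting [h1] along
    [x] and [c] gives [h1] as [t0 + s] up to approximation. Cancelling [s] shows
    that the summand [t0] inherits the small gap of [h1], and that it contains
    [x'] up to the error. *)
Lemma fine_of_large e :
  (forall x' x, x' `<< x ->
    exists h0 h1, [/\ h0 `<< h1, h1 <= h0 + e & x' <= h1]) -> fine e.
Proof.
move=> large x' x x'x.
have [x3 x'3 x3x] := way_below_interp x'x.
have [x2 x'2 x23] := way_below_interp x'3.
have [x1 x'1 x12] := way_below_interp x'2.
have [h0 [h1 [h01 h1e x3h]]] := large _ _ x3x.
have x2h : x2 <= h1 by apply: le_trans x3h; apply: way_below_le.
have [c x1c hc] := complement x12 x2h.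
have [h h0h hh1] := way_below_interp h01.
have [t [t0 [s' [s [[tt0 t0x] [s's sc] h0ts t0sh]]]]] :=
  split2 h0h (way_below_le_trans hh1 hc).
have h1ts : h1 <= t + e + s.
  apply: le_trans h1e _; rewrite addrAC; apply: cu_leD => //.
  apply: le_trans (way_below_le h0ts) _.
  by apply: cu_leD => //; apply: way_below_le.
(* Cancel [s] from [t0 + s << t + e + s] and from [x' + s << t + e + s]. *)
have t0e : t0 `<< t + e.
  apply: (wcancel (z := s)).
  exact: way_below_le_trans t0sh (le_trans (way_below_le hh1) h1ts).
have x't : x' `<< t + e.
  apply: (wcancel (z := s)); apply: way_below_le_trans h1ts.
  by apply: way_below_le_trans (cu_O3 _ _ _ _ x'1 sc) x1c.
exists t, t0; split=> //; last exact: way_below_le_trans x't (cu_leDl _ _).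
  by apply: way_below_trans t0x (way_below_trans x23 x3x).
exact: way_below_le.
Qed.

(** Here [h0] and [h1] are the sums of the first and of the last [n] terms of a
    chain [f = f_0 << .. << f_n = g << e]. The [n] gaps between consecutive
    terms telescope to at most [g]. *)
Lemma chain_sum f e n : f `<< e ->
  exists h0 h1 g, [/\ h0 `<< h1, f *+ n <= h1, f <= g, g `<< e & h1 <= h0 + g].
Proof.
move=> fe; elim: n => [|n [h0 [h1 [g [h01 fh fg ge hg]]]]].
  exists 0, 0, f; split=> //; [exact: way_below0|by rewrite add0r cu_le0x].
have [g1 gg1 g1e] := way_below_interp ge; have gg1' := way_below_le gg1.
exists (h0 + g), (h1 + g1), g1; split=> //.
- exact: cu_O3.
- by rewrite mulrSr; apply: cu_leD => //; apply: le_trans gg1'.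
- exact: le_trans gg1'.
- exact: cu_leD.
Qed.

Lemma fine_neq0 e : e <> 0 -> fine e.
Proof.
move=> /way_below_neq0 [f f0 fe]; apply: fine_of_large => x' x x'x.
have [n x'n] := way_below_mulrn f0 x'x.
have [h0 [h1 [g [h01 fh _ ge hg]]]] := chain_sum n fe.
exists h0, h1; split=> //; last exact: le_trans fh.
by apply: le_trans hg _; apply: cu_leD => //; apply: way_below_le.
Qed.

Lemma fine0 p : p <> 0 -> p `<< p -> fine 0.
Proof.
move=> p0 pp; apply: fine_of_large => x' x x'x.
have [n x'n] := way_below_mulrn p0 x'x.
by exists (p *+ n), (p *+ n); split; rewrite ?addr0 //; apply: way_belowMn.
Qed.

(** The complement of an approximant in [w1] cannot vanish, since [w1] would
    then be compact. *)
Lemma soft_slack a w : ~ (exists2 p : S, p <> 0 & p `<< p) ->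
  w <> 0 -> a `<< w -> exists2 f, f <> 0 & a + f `<< w.
Proof.
move=> soft w0 aw; have [w1 [w10 aw1 w1w]] := way_below_interp_neq0 aw w0.
have [b ab bw1] := way_below_interp aw1.
have [c ac wc] := complement ab (way_below_le bw1).
exists c; last exact: le_way_below_trans w1w.
move=> c0; apply: soft; exists w1 => //.
by apply: le_way_below_trans bw1; rewrite c0 addr0 in wc.
Qed.

Lemma soft_slack_seq (l : seq (S * S)) : ~ (exists2 p : S, p <> 0 & p `<< p) ->
  (exists x : S, x <> 0) ->
  (forall p : S * S, p \in l -> p.2 <> 0 /\ p.1 `<< p.2) ->
  exists2 f, f <> 0 & forall p : S * S, p \in l -> p.1 + f `<< p.2.
Proof.
move=> soft [x x0]; elim: l => [|p l IH] lP; first by exists x.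
have [|f f0 fl] := IH.
  by move=> q ql; apply: lP; rewrite inE ql orbT.
have [p0 pp] := lP p (mem_head _ _).
have [g g0 gp] := soft_slack soft p0 pp.
have [h [h0 hf hg]] := common_lower_bound f0 g0.
exists h => // q; rewrite inE => /orP[/eqP->|/fl qf].
  by apply: le_way_below_trans gp; apply: cu_leD.
by apply: le_way_below_trans qf; apply: cu_leD.
Qed.

(** This is where the algebraic case (error 0) and the case without nonzero
    compact elements (nonzero error) are merged, so that the rest of the
    argument treats them uniformly. *)
Lemma fine_slack n (l : seq (S * S)) :
  (forall p : S * S, p \in l -> p.2 <> 0 /\ p.1 `<< p.2) ->
  exists2 e, fine e & forall p : S * S, p \in l -> p.1 + e *+ n `<< p.2.
Proof.
move=> lP.
case: (pselect (exists2 p : S, p <> 0 & p `<< p)) => [[p p0 pp]|soft].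
  exists 0; first exact: fine0 pp.
  by move=> q /lP [_ qq]; rewrite mul0rn addr0.
case: (pselect (exists x : S, x <> 0)) => [ex0|all0]; last first.
  exists 0 => [x' x _|q /lP [q0 _]]; last by case: all0; exists q.2.
  have S0 y : y = 0 by apply: contrapT => y0; apply: all0; exists y.
  rewrite (S0 x) (S0 x'); exists 0, 0; rewrite !addr0.
  by split=> //; apply: way_below0.
have [f f0 fl] := soft_slack_seq soft ex0 lP.
have [|e e0 en] := small_multiple n _ f0.
  move=> [y miny]; apply: soft; exists y; first by case: miny.
  exact: minimal_nonzero_way_below.
exists e; first exact: fine_neq0.
by move=> p /fl; apply: le_way_below_trans; apply: cu_leD.
Qed.

(** Room for two errors below [x] turns the approximate lower bound in the
    definition of [fine] into an honest one. *)
Lemma fine_approx e x' x : fine e -> x' + e *+ 2 `<< x ->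
  exists t t0, [/\ x' <= t, t `<< t0, t0 `<< x & t0 <= t + e].
Proof.
move=> fe x'x; have [s [s0 [ss0 s0x s0e x's]]] := fe _ _ x'x.
have x's0 : x' `<< s0.
  apply: way_below_le_trans (way_below_le ss0).
  apply: (wcancel (z := e *+ 2)).
  by move: x's; rewrite -[s + e + e]addrA -mulr2n.
have [t [st x't tt0]] := way_below_directed ss0 x's0.
exists t, s0; split=> //; first exact: way_below_le.
by apply: le_trans s0e _; apply: cu_leD => //; apply: way_below_le.
Qed.

(** * Riesz interpolation *)

(** This is the monoid argument, with [t] in the role of [a]. The gap between
    [t] and [t0] costs one error [e] in each of [y <= t + c + e] and [w <= t + g
    + e]. The hypotheses on [b + e] absorb it, so that [b] lies way below both
    [t + c] and [t + g]. *)
Lemma interpolation_of_tight e t t0 b' b y w :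
  t `<< t0 -> t0 <= t + e -> t0 <= y -> t0 <= w -> b' `<< b ->
  b + e `<< y -> b + e `<< w ->
  exists z, [/\ t <= z, b' <= z, z <= y & z <= w].
Proof.
move=> tt0 t0e t0y t0w b'b b_y b_w.
have ext v : t0 <= v -> b + e `<< v -> exists2 c, t + c <= v & b `<< t + c.
  move=> t0v bv; have [c tc vc] := complement tt0 t0v.
  exists c => //; apply: (wcancel (z := e)).
  apply: way_below_le_trans bv _; apply: le_trans vc _.
  by rewrite addrAC; apply: cu_leD2r.
have [c tcy btc] := ext y t0y b_y.
have [g tgw btg] := ext w t0w b_w.
have [u' [u [v' [v [[u'u ut] [v'v vc] b'uv uvb]]]]] := split2 b'b btc.
have [q u'q tuq] := complement u'u (way_below_le ut).
(* Cancel [u] in [u + v << t + g <= u + q + g]. *)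
have vqg : v `<< q + g.
  apply: (wcancel (z := u)); rewrite addrC [_ + u]addrC addrA.
  apply: way_below_trans uvb (way_below_le_trans btg _).
  exact: cu_leD2r.
have [q1 [g1 [q1q g1g v'qg qgv]]] := dim_le0_split dim0 v'v vqg.
exists (t + g1); split.
- exact: cu_leDl.
- apply: le_trans (way_below_le b'uv) _.
  apply: (@le_trans _ _ (u' + q + g1)); last exact: cu_leD2r.
  rewrite -addrA; apply: cu_leD => //; apply: le_trans (way_below_le v'qg) _.
  by apply: cu_leD2r; apply: way_below_le.
- apply: le_trans tcy; apply: cu_leD => //; apply: le_trans (way_below_le vc).
  exact: le_trans (cu_leDr _ _) (way_below_le qgv).
- by apply: le_trans tgw; apply: cu_leD => //; apply: way_below_le.
Qed.

(** The tight pair is chosen between [a'] and [a], with an error small enough to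
    fit also between [b] and each of [y] and [w]. *)
Lemma interpolation_le a' a b' b y w :
  a' `<< a -> b' `<< b -> a `<< y -> a `<< w -> b `<< y -> b `<< w ->
  exists z, [/\ a' <= z, b' <= z, z <= y & z <= w].
Proof.
move=> a'a b'b ay aw b_y b_w.
case: (eqVneq a 0) => [a0|/eqP a0].
  exists b; split; try exact: way_below_le.
  by apply: le_trans (cu_le0x b); rewrite -a0; apply: way_below_le.
have y0 := cu_neq0_le a0 (way_below_le ay).
have w0 := cu_neq0_le a0 (way_below_le aw).
have [|e fe el] := @fine_slack 2 [:: (a', a); (b, y); (b, w)].
  by move=> p; rewrite !inE => /or3P[] /eqP ->.
have [t [t0 [a't tt0 t0a t0e]]] := fine_approx fe (el (a', a) (mem_head _ _)).
have bv v : (b, v) \in [:: (a', a); (b, y); (b, w)] -> b + e `<< v.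
  move=> /el /=; apply: le_way_below_trans; apply: cu_leD => //.
  by rewrite mulr2n cu_leDl.
have [||||z [tz b'z zy zw]] :=
  interpolation_of_tight tt0 t0e _ _ b'b (bv y _) (bv w _).
- exact: way_below_le (way_below_trans t0a ay).
- exact: way_below_le (way_below_trans t0a aw).
- by rewrite !inE eqxx orbT.
- by rewrite !inE eqxx !orbT.
by exists z; split=> //; apply: le_trans tz.
Qed.

(** Producing a pair [z' << z] instead of a single interpolant allows the next
    interpolation step to start from the result of the previous one. *)
Lemma interpolation_way_below a' a b' b y w :
  a' `<< a -> b' `<< b -> a `<< y -> a `<< w -> b `<< y -> b `<< w ->
  exists z' z, [/\ a' <= z', b' <= z', z' `<< z, z `<< y & z `<< w].
Proof.
move=> a'a b'b ay aw b_y b_w.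
have [a1 a'1 a1a] := way_below_interp a'a.
have [b1 b'1 b1b] := way_below_interp b'b.
have [y1 [ay1 by1 y1y]] := way_below_directed ay b_y.
have [w1 [aw1 bw1 w1w]] := way_below_directed aw b_w.
have [z [az bz zy zw]] := interpolation_le a1a b1b ay1 aw1 by1 bw1.
have [z' [a'z b'z z'z]] :=
  way_below_directed (way_below_le_trans a'1 az) (way_below_le_trans b'1 bz).
exists z', z; split=> //; try exact: way_below_le.
  exact: le_way_below_trans y1y.
exact: le_way_below_trans w1w.
Qed.

(** The supremum of a sequence of interpolants that exhausts [x0] and [x1], each
    one above its predecessors, interpolates exactly. *)
Lemma interpolation2 x0 x1 y w : x0 <= y -> x0 <= w -> x1 <= y -> x1 <= w ->
  exists z, [/\ x0 <= z, x1 <= z, z <= y & z <= w].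
Proof.
move=> x0y x0w x1y x1w.
have [u [_ us uu ux]] := way_below_seqP x0.
have [v [_ vs vv vx]] := way_below_seqP x1.
pose good (p : S * S) := [/\ p.1 `<< p.2, p.2 `<< y & p.2 `<< w].
have step n (p : S * S) : exists q : S * S,
    good p -> [/\ good q, p.1 <= q.1, u n <= q.1 & v n <= q.1].
  case: (pselect (good p)) => [[pp py pw]|]; last by exists p.
  have [r' [r [ur vr r'r ry rw]]] := interpolation_way_below (uu n) (vv n)
    (way_below_le_trans (ux _) x0y) (way_below_le_trans (ux _) x0w)
    (way_below_le_trans (vx _) x1y) (way_below_le_trans (vx _) x1w).
  have [z' [z [pz rz z'z zy zw]]] := interpolation_way_below pp r'r py pw ry rw.
  by exists (z', z) => _; split=> //=; [exact: le_trans rz|exact: le_trans rz].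
have [F FP] := choice (fun np : nat * (S * S) => step np.1 np.2).
pose s := fix s n := if n is m.+1 then F (m, s m) else (0 : S, 0 : S).
have sgood n : good (s n).
  elim: n => [|n IH]; first by split; apply: way_below0.
  by case: (FP (n, s n) IH).
have sP n : [/\ (s n).1 <= (s n.+1).1, u n <= (s n.+1).1 & v n <= (s n.+1).1].
  by case: (FP (n, s n) (sgood n)).
have [|z zs] := @cu_O1 _ S (fun n => (s n).1); first by move=> n; case: (sP n).
exists z; split.
- apply: seq_sup_le us _ => n; apply: le_trans (seq_sup_ub n.+1 zs).
  by case: (sP n).
- apply: seq_sup_le vs _ => n; apply: le_trans (seq_sup_ub n.+1 zs).
  by case: (sP n).
- apply: seq_sup_le zs _ => n; have [ss sy _] := sgood n.
  exact: way_below_le (way_below_trans ss sy).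
- apply: seq_sup_le zs _ => n; have [ss _ sw] := sgood n.
  exact: way_below_le (way_below_trans ss sw).
Qed.

Lemma zero_dim_riesz : riesz_interpolation S.
Proof.
move=> x y xy.
have [z [x0z x1z zy0 zy1]] := interpolation2 (xy ord0 ord0) (xy ord0 ord_max)
  (xy ord_max ord0) (xy ord_max ord_max).
have ord2 (P : 'I_2 -> Prop) : P ord0 -> P ord_max -> forall i, P i.
  move=> P0 P1 [[|[|//]] lti].
    by rewrite (_ : Ordinal lti = ord0) //; apply: val_inj.
  by rewrite (_ : Ordinal lti = ord_max) //; apply: val_inj.
by exists z => j k; split; [move: j; apply: ord2|move: k; apply: ord2].
Qed.

(** * Almost divisibility *)

(** The element [y *+ m + r] with [r << y *+ k] is divided by induction on [k].
    Split off the part [t] of [r] that lies in the first copy of [y], and write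
    [y] as [t + c]. The rest of [r] splits along [t *+ k] and [c *+ k] into [p]
    and [q]. Now [t *+ m.+1 + p] and [c *+ m + q] are instances for [k], and
    their quotients add up to the required [z]. For [k = 0] the quotient is a
    multiple of [y], which exists as soon as some integer lies between [m / (n +
    1)] and [m / n]; this is ensured by [n * n <= m]. The number [K] of errors
    depends on [n], [k] and [m] only, so [e] may be chosen after [K]. *)
Lemma divide_with_error n k m : (0 < n)%N -> (n * n <= m)%N ->
  exists K, forall e y r' r, fine e -> r' `<< r -> r `<< y *+ k ->
  exists2 z, z *+ n <= y *+ m + r & y *+ m + r' <= z *+ n.+1 + e *+ K.
Proof.
move=> n0; elim: k m => [|k IH] m nm.
  exists 0%N => e y r' r _ r'r; rewrite mulr0n => /way_below_le/cu_le0_eq r0.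
  have r'0 : r' = 0 by apply: cu_le0_eq; rewrite -r0; apply: way_below_le.
  exists (y *+ (m %/ n)); rewrite ?r0 ?r'0 !addr0 -mulrnA; apply: cu_leMnr.
    exact: leq_divM.
  rewrite mulnS; apply: leq_trans (ltnW (ltn_ceil m n0)) _.
  by rewrite mulSn leq_add2r leq_divRL.
have [K1 K1P] := IH m.+1 (leqW nm); have [K2 K2P] := IH m nm.
exists (K1 + K2 + (m + 2 + k))%N => e y r' r fe r'r ry.
rewrite mulrS in ry.
have [r1' [r1 [r2' [r2 [[r11 r1y] [r22 r2y] r'12 r12]]]]] := split2 r'r ry.
have [t [t0 [tt0 t0r t0e r1t]]] := fe _ _ r11.
have [c tcy ytc] := complement tt0 (way_below_le (way_below_trans t0r r1y)).
have {}ytc : y <= t + c + e.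
  by apply: le_trans ytc _; rewrite addrAC; apply: cu_leD.
(* The piece of [r2] below [e *+ k] is given up as an error. *)
have {}r2y : r2 `<< t *+ k + c *+ k + e *+ k.
  by apply: way_below_le_trans r2y _; rewrite -!mulrnDl; apply: cu_leMn.
have [p' [p [q' [q [s [[p'p pt] [q'q qc] se r2pq pqs]]]]]] := split3 r22 r2y.
have [z1 z1n nz1] := K1P _ _ _ _ fe p'p pt.
have [z2 z2n nz2] := K2P _ _ _ _ fe q'q qc.
exists (z1 + z2).
  rewrite mulrnDl; apply: le_trans (cu_leD z1n z2n) _.
  apply: (@le_trans _ _ ((t + c) *+ m + (t + (p + q + s)))); last first.
    apply: cu_leD; first exact: cu_leMn.
    apply: le_trans (way_below_le r12); apply: cu_leD; last exact: way_below_le.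
    exact: way_below_le (way_below_trans tt0 t0r).
  rewrite mulrSr mulrnDl.
  rewrite (AC (3*2) ((1*4)*(2*(3*5)))) /=.
  by do 2 apply: cu_leD => //; apply: cu_leDl.
apply: (@le_trans _ _ ((t + c + e) *+ m + (t + e + e + (p' + q' + e *+ k)))).
  apply: cu_leD; first exact: cu_leMn.
  apply: le_trans (way_below_le r'12) _; apply: cu_leD.
    exact: way_below_le.
  apply: le_trans (way_below_le r2pq) _.
  by apply: cu_leD => //; apply: way_below_le.
rewrite !mulrnDl !mulrnDr mulr2n.
rewrite (AC (3*(3*3)) (((1*4*7)*(2*8))*(3*(5*6)*9))) /=.
rewrite [leRHS](AC (2*(2*3)) ((1*3)*(2*4)*(5*6*7))) /=.
apply: cu_leD => //; apply: cu_leD; last exact: nz2.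
by rewrite -mulrSr.
Qed.

(** Choose [y] so small that [y *+ (n * n)] lies below an approximant of [x],
    then bounds [k] and [K], then an error [e] that fits [K + n * n] times above
    [x'], and only then replace [y] by a tight [t] with error [e]. To keep [k]
    valid for [t], it is computed from an approximant of [y] that stays below
    [t]. *)
Lemma zero_dim_almost_divisible :
  ~ (exists y : S, minimal_nonzero y) -> almost_divisible S.
Proof.
move=> nomin n x' x n0 x'x.
case: (eqVneq x 0) => [x0|/eqP x0].
  exists 0; rewrite !mul0rn; split; first exact: way_below0.
  by rewrite -x0.
have [x3 [x30 x'3 x3x]] := way_below_interp_neq0 x'x x0.
have [x2 [x20 x'2 x23]] := way_below_interp_neq0 x'3 x30.
have [x1 [x10 x'1 x12]] := way_below_interp_neq0 x'2 x20.
have [y y0 yx2] := small_multiple (n * n) nomin x20.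
have [y' y'0 y'y] := way_below_neq0 y0.
have [y'' y''0 y''y] := way_below_neq0 y'0.
have [k x2k] := way_below_mulrn y''0 x23.
have [K KP] := divide_with_error k n0 (leqnn (n * n)).
have [|e fe el] := @fine_slack (K + n * n + 2) [:: (x', x1); (y', y)].
  by move=> p; rewrite !inE => /orP[] /eqP ->.
have x'e : x' + e *+ (K + n * n) `<< x1.
  move: (el (x', x1)) => /=; rewrite inE eqxx => /(_ isT).
  apply: le_way_below_trans; apply: cu_leD => //.
  by apply: cu_leMnr; apply: leq_addr.
have y'e : y' + e *+ 2 `<< y.
  move: (el (y', y)) => /=; rewrite !inE eqxx orbT => /(_ isT).
  apply: le_way_below_trans; apply: cu_leD => //.
  by apply: cu_leMnr; apply: leq_addl.
have [t [t0 [y't tt0 t0y t0e]]] := fine_approx fe y'e.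
have [|r tr xr] := @complement _ _ x2 (way_belowMn (n := n * n) tt0).
  by apply: le_trans yx2; apply: cu_leMn; apply: way_below_le.
have x1r : x1 `<< r + (t *+ (n * n) + e *+ (n * n)).
  apply: way_below_le_trans x12 _; apply: le_trans xr _.
  by rewrite addrC -mulrnDl; apply: cu_leD => //; apply: cu_leMn.
have [r' [s [r'r /way_below_le sle /way_below_le x1s]]] := way_belowD_split x1r.
have rt : r `<< t *+ k.
  apply: (le_way_below_trans (y := y'' *+ k)).
    exact: le_trans (cu_leDr _ _) (le_trans tr x2k).
  by apply: way_below_le_trans (way_belowMn y''y) _; apply: cu_leMn.
have [z zn nz] := KP _ _ _ _ fe r'r rt.
exists z; split.
  exact: le_way_below_trans (le_trans zn tr) (way_below_trans x23 x3x).
apply: (wcancel (z := e *+ (K + n * n))); apply: way_below_le_trans x'e _.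
apply: le_trans x1s _; rewrite mulrnDr addrA.
apply: (@le_trans _ _ (t *+ (n * n) + r' + e *+ (n * n))); last exact: cu_leD.
by rewrite [_ + r']addrC -addrA; apply: cu_leD.
Qed.

End ZeroDimensional.

Theorem proposition5p8 (d : Order.disp_t) (S : cuSemigroupType d) :
  cu_dim S = Some 0%N ->
  simple S ->
  weakly_cancellative S ->
  axiom_O5 S ->
  riesz_interpolation S /\ (~ elementary S -> almost_divisible S).
Proof.
move=> /cu_dim_le dim0 simpleS wcancel O5; split; first exact: zero_dim_riesz.
move=> nonel; apply: zero_dim_almost_divisible => // minimal.
by apply: nonel; right.
Qed.
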